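(* Let $\alpha,\beta>-1$ be real numbers. Consider the multiplicative differential equation $$\left(y^{**}\right)^{1-x^2}\left(y^{*}\right)^{\beta-\alpha-(\alpha+\beta+2)x}\,y^{\gamma}=1,\qquad x\in[-1,1], \qquad (\mathrm{E})$$ where $\gamma\in\mathbb{R}$ is a spectral parameter. The equation (E) has a multiplicative polynomial solution, not identically one, of the form $y(x)=\prod_{k=0}^{n}(a_k)^{(x-1)^k}$ ($a_k\in\mathbb{R}_e$) if and only if $\gamma=n(n+\alpha+\beta+1)$ for every non-negative integer $n$. Moreover, the solution $y^c$ ($c$ constant) is the only multiplicative polynomial solution, i.e. every other solution of (E) that is (multiplicatively) linearly independent to $y$ on $(-1,1)$ is not a multiplicative polynomial.
   Context: $\mathbb{R}_e=\{e^x:x\in\mathbb{R}\}=(0,\infty)$. For a positive function $y$, the multiplicative derivative is $y^*(x)=\lim_{h\to0}[y(x+h)/y(x)]^{1/h}$, equivalently $y^*=e^{(\ln y)'}$, and $y^{**}=(y^* )^*=e^{(\ln y)''}$. Solutions are positive functions. A multiplicative polynomial is a function of the form $\prod_{k=0}^{m}(b_k)^{(x-x_0)^k}$ with $b_k\in\mathbb{R}_e$, i.e. a function $e^{p(x)}$ with $p$ a real polynomial. Positive functions $y_1,\dots,y_m$ are multiplicatively linearly independent on an interval $I$ if the only real scalars $c_1,\dots,c_m$ with $\prod_{k}y_k(x)^{c_k}=1$ for all $x\in I$ are $c_1=\dots=c_m=0$.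
   Formalization: The displayed solution is required to have degree exactly n, i.e. a_n ≠ 1; without this the equivalence fails (γ = 0, y a constant other than 1, α = β = 0, n = 1). *)

(* Defs.v *)
From mathcomp Require Import all_boot all_order all_algebra.
From mathcomp Require Import all_classical all_reals all_analysis.

Set Implicit Arguments.
Unset Strict Implicit.
Unset Printing Implicit Defensive.

Import Order.TTheory GRing.Theory Num.Theory.
Import numFieldNormedType.Exports.

Local Open Scope classical_set_scope.
Local Open Scope ring_scope.

(* [l] is the multiplicative derivative at [x] of [y : I -> (0, oo)]. Only
   increments staying in [I] are considered, so that the limit is one-sided at
   an endpoint of [I] and two-sided in its interior; [l] must lie in (0, oo). *)
Definition is_mderiv (R : realType) (I : set R) (y : R -> R) (x l : R) : Prop :=
  0 < l /\
  (fun h : R => (y (x + h) / y x) `^ h^-1)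
    @ within [set h | I (x + h)] 0^' --> l.

Definition mjacobi_solution (R : realType) (alpha beta gamma : R)
    (I : set R) (y : R -> R) : Prop :=
  (forall x, I x -> 0 < y x) /\
  exists y1 y2 : R -> R,
    [/\ forall x, I x -> is_mderiv I y x (y1 x),
        forall x, I x -> is_mderiv I y1 x (y2 x) &
        forall x, I x ->
          y2 x `^ (1 - x ^+ 2)
          * y1 x `^ (beta - alpha - (alpha + beta + 2) * x)
          * y x `^ gamma = 1].

Definition mpoly (R : realType) (n : nat) (x0 : R) (a : 'I_n.+1 -> R)
    (x : R) : R :=
  \prod_(k < n.+1) a k `^ ((x - x0) ^+ k).

Definition is_mpoly (R : realType) (I : set R) (y : R -> R) : Prop :=
  exists (m : nat) (x0 : R) (b : 'I_m.+1 -> R),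
    (forall k, 0 < b k) /\ forall x, I x -> y x = mpoly x0 b x.

Definition mlin_indep (R : realType) (I : set R) (m : nat)
    (y : 'I_m -> R -> R) : Prop :=
  forall c : 'I_m -> R,
    (forall x, I x -> \prod_(k < m) y k x `^ c k = 1) -> forall k, c k = 0.

(* The top coefficient differs from 1, i.e. the exponent has degree exactly [n]:
   were smaller degrees allowed, a constant would solve the equation with
   [gamma = 0] for every [n]. *)
Definition mjacobi_mpoly_solution (R : realType) (alpha beta gamma : R)
    (n : nat) (a : 'I_n.+1 -> R) : Prop :=
  [/\ forall k, 0 < a k,
      a ord_max != 1,
      (exists2 x : R, `[-1, 1]%classic x & mpoly 1 a x != 1) &
      mjacobi_solution alpha beta gamma `[-1, 1] (mpoly 1 a)].

(* Main.v *)
Require Import Defs.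
From mathcomp Require Import all_boot all_order all_algebra.
From mathcomp Require Import all_classical all_reals all_analysis.
From mathcomp Require Import ring lra.

Set Implicit Arguments.
Unset Strict Implicit.
Unset Printing Implicit Defensive.

Import Order.TTheory GRing.Theory Num.Theory.
Import numFieldNormedType.Exports.

Local Open Scope classical_set_scope.
Local Open Scope ring_scope.

(** Writing [y = exp p], the multiplicative equation becomes the Jacobi equation
    for [p], and for a polynomial [p] it is an identity of polynomials. In powers
    of [t = x - 1] it amounts to the two-term recurrence
    [2 (k + 1) (k + 1 + alpha) p_(k+1) = (gamma - k (k + alpha + beta + 1)) p_k].
    As [alpha > -1], the left factor is positive, so polynomial solutions are
    determined up to a scalar by [p_0]. A solution of degree exactly [n] forces
    [gamma] to be the [n]-th eigenvalue; for that value, the recurrence started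
    at [p_0 = 1] keeps positive coefficients up to [p_n] and then vanishes. *)

(** The multiplicative difference quotient of [expR \o f] is [expR] of the ordinary one, so
    continuity of [expR] carries the limit over. Restricting the increments to those staying in [I]
    only refines the filter. *)
Lemma is_mderiv_expR (R : realType) (I : set R) (y f : R -> R) (x d : R) :
  I x -> (forall t, I t -> y t = expR (f t)) -> is_derive x 1 f d ->
  is_mderiv I y x (expR d).
Proof.
move=> Ix yE [fx <-]; split; first exact: expR_gt0.
have yq h : I (x + h) ->
    expR (h^-1 *: ((f \o shift x) (h *: 1) - f x)) = (y (x + h) / y x) `^ h^-1.
  move=> Ixh; rewrite !yE// -expRN -expRD -expRM /=; congr expR.
  by rewrite /GRing.scale /= mulr1 mulrC (addrC h).
apply: (@cvg_trans _ ((fun h : R => expR (h^-1 *: ((f \o shift x) (h *: 1) - f x)))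
    @ within [set h | I (x + h)] 0^')).
  by apply: near_eq_cvg; rewrite near_withinE; apply: nearW => h; exact: yq.
apply: cvg_within_filter.
exact: (continuous_cvg _ (@continuous_expR R _) fx).
Qed.

(** The distinct points [- 1 / (i + 2)] all have the form [x - 1] with [x] in the open interval;
    taking [size q] of them gives more roots than a nonzero [q] allows. *)
Lemma poly_eq0_on (R : realType) (q : {poly R}) :
  (forall x, `]-1, 1[%classic x -> q.[x - 1] = 0) -> q = 0.
Proof.
move=> q0; apply/eqP/negPn/negP => qN0.
pose g (i : nat) : R := - (i.+2%:R)^-1.
have ginj : injective g.
  by move=> i j /oppr_inj/invr_inj/eqP; rewrite eqr_nat => /eqP[].
have : (size [seq g i | i <- iota 0 (size q)] < size q)%N.
  apply: (max_poly_roots qN0); last by rewrite map_inj_uniq ?iota_uniq.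
  apply/allP => _ /mapP[i _ ->]; apply/rootP.
  have -> : g i = (g i + 1) - 1 by rewrite addrK.
  apply: q0; rewrite /= in_itv /= /g.
  have i0 : (0 : R) < i.+2%:R^-1 by rewrite invr_gt0.
  have i1 : i.+2%:R^-1 < 1 :> R by rewrite invf_lt1 ?ltr1n.
  by move: (i.+2%:R^-1) i0 i1 => u u0 u1; apply/andP; split; lra.
by rewrite size_map size_iota ltnn.
Qed.

(** * Uniqueness of the multiplicative derivative *)

Section Intervals.
Variables (R : realType) (I : set R).
Hypothesis subI : `]-1, 1[ `<=` I.
Hypothesis Isub : I `<=` `[-1, 1].

(** Stepping towards the far half of the interval, right if [x <= 0] and left otherwise, by at most
    [1 / 2] stays in the open interval even from an endpoint. Properness of this filter is what
    makes limits along it unique. *)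
Lemma within_increments_proper (x : R) : I x ->
  ProperFilter (within [set h | I (x + h)] (0 : R)^').
Proof.
move=> Ix; apply: Build_ProperFilter_ex => P [e /= e0 eP].
have := Isub Ix; rewrite /= in_itv /= => /andP[x1 x2].
pose m := Num.min (e / 2) (1 / 2).
have m0 : 0 < m by rewrite lt_min; apply/andP; split; lra.
have me : m < e by rewrite gt_min; apply/orP; left; lra.
have m1 : m <= 1 / 2 by rewrite ge_min lexx orbT.
have [xle|xgt] := lerP x 0.
  exists m; apply: eP => /=.
  - by rewrite sub0r normrN gtr0_norm.
  - by rewrite gt_eqF.
  - by apply: subI; rewrite /= in_itv /=; lra.
exists (- m); apply: eP => /=.
- by rewrite sub0r opprK gtr0_norm.
- by rewrite oppr_eq0 gt_eqF.
- by apply: subI; rewrite /= in_itv /=; lra.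
Qed.

Lemma is_mderiv_unique (y : R -> R) (x l l' : R) : I x ->
  is_mderiv I y x l -> is_mderiv I y x l' -> l = l'.
Proof.
move=> Ix [_ yl] [_ yl'].
have PF := within_increments_proper Ix.
exact: (cvg_unique (@norm_hausdorff _ R) yl yl').
Qed.

End Intervals.

Lemma is_derive_poly_shift (R : realType) (q : {poly R}) (x : R) :
  is_derive x 1 (fun t => q.[t - 1]) q^`().[x - 1].
Proof.
have -> : (fun t => q.[t - 1]) = horner (q \Po ('X - 1%:P)).
  by apply/funext => t; rewrite horner_comp !hornerE.
have -> : q^`().[x - 1] = (q \Po ('X - 1%:P))^`().[x].
  by rewrite deriv_comp derivB derivX derivC subr0 mulr1 horner_comp !hornerE.
exact: is_derive_poly.
Qed.

(* The Jacobi operator in the variable [t = x - 1], for which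
   [1 - x^2 = - t (t + 2)]. *)
Definition jacobi_op (R : realType) (alpha beta gamma : R) (q : {poly R}) :=
  - ('X * ('X * q^`()^`())) - 2 *: ('X * q^`()^`())
  - (2 * (alpha + 1)) *: q^`() - (alpha + beta + 2) *: ('X * q^`())
  + gamma *: q.

Lemma horner_jacobi_op (R : realType) (alpha beta gamma : R) (q : {poly R}) x :
  (jacobi_op alpha beta gamma q).[x - 1] =
  (1 - x ^+ 2) * q^`()^`().[x - 1]
  + (beta - alpha - (alpha + beta + 2) * x) * q^`().[x - 1]
  + gamma * q.[x - 1].
Proof. by rewrite /jacobi_op !(hornerD, hornerN, hornerZ, hornerM, hornerX); ring. Qed.

Definition jacobi_rec (R : realType) (alpha beta gamma : R) (q : {poly R}) :=
  forall k : nat, 2 * (k%:R + 1) * (k%:R + 1 + alpha) * q`_k.+1 =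
    (gamma - k%:R * (k%:R + alpha + beta + 1)) * q`_k.

Lemma jacobi_opP (R : realType) (alpha beta gamma : R) (q : {poly R}) :
  jacobi_op alpha beta gamma q = 0 <-> jacobi_rec alpha beta gamma q.
Proof.
have cE k : (jacobi_op alpha beta gamma q)`_k =
    (gamma - k%:R * (k%:R + alpha + beta + 1)) * q`_k
    - 2 * (k%:R + 1) * (k%:R + 1 + alpha) * q`_k.+1.
  rewrite /jacobi_op !(coefD, coefN, coefZ, coefXM, coef_deriv).
  (* Multiplying by ['X] twice shifts indices by two, so the indices 0 and 1 are computed apart. *)
  by case: k => [|[|k]] /=; ring.
split=> [q0 k|rq].
  by apply/eqP; rewrite eq_sym -subr_eq0 -cE q0 coef0.
by apply/polyP => k; rewrite cE rq subrr coef0.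
Qed.

(** * Equivalence of the multiplicative equation and the recurrence *)

Section Solutions.
Variables (R : realType) (alpha beta gamma : R) (I : set R).
Hypothesis subI : `]-1, 1[ `<=` I.
Hypothesis Isub : I `<=` `[-1, 1].

Lemma mjacobi_solution_expR (y : R -> R) (q : {poly R}) :
  (forall x, I x -> y x = expR q.[x - 1]) ->
  mjacobi_solution alpha beta gamma I y <-> jacobi_rec alpha beta gamma q.
Proof.
move=> yE; rewrite -jacobi_opP.
have md (z : R -> R) (p : {poly R}) : (forall x, I x -> z x = expR p.[x - 1]) ->
    forall x, I x -> is_mderiv I z x (expR p^`().[x - 1]).
  by move=> zE x Ix; apply: is_mderiv_expR zE (is_derive_poly_shift _ _).
have eqn x : expR q^`()^`().[x - 1] `^ (1 - x ^+ 2)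
    * expR q^`().[x - 1] `^ (beta - alpha - (alpha + beta + 2) * x)
    * expR q.[x - 1] `^ gamma = expR (jacobi_op alpha beta gamma q).[x - 1].
  by rewrite -!expRM -!expRD horner_jacobi_op; congr expR; ring.
split=> [[_ [y1 [y2 [yy1 y1y2 ode]]]]|q0].
  apply: poly_eq0_on => x /subI Ix.
  have y1E t : I t -> y1 t = expR q^`().[t - 1].
    by move=> It; apply: (is_mderiv_unique subI Isub It (yy1 _ It)); exact: md.
  have y2E t : I t -> y2 t = expR q^`()^`().[t - 1].
    by move=> It; apply: (is_mderiv_unique subI Isub It (y1y2 _ It)); exact: md.
  by apply: expR_inj; rewrite expR0 -eqn -yE// -y1E// -y2E// ode.
split=> [x Ix|]; first by rewrite yE// expR_gt0.
exists (fun x => expR q^`().[x - 1]), (fun x => expR q^`()^`().[x - 1]).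
split=> x Ix; [exact: md | exact: md |].
by rewrite yE// eqn q0 horner0 expR0.
Qed.

End Solutions.

(** * Polynomial solutions of the recurrence *)

Section Recurrence.
Variables (R : realType) (alpha beta gamma : R).
Hypothesis alpha_gtN1 : -1 < alpha.

Lemma jacobi_rec_coef_gt0 (k : nat) :
  0 < 2 * (k%:R + 1) * (k%:R + 1 + alpha) :> R.
Proof.
have k0 : 0 <= k%:R :> R by rewrite ler0n.
by rewrite !mulr_gt0//; move: alpha_gtN1; lra.
Qed.

Lemma jacobi_rec_eq0 (q : {poly R}) :
  jacobi_rec alpha beta gamma q -> q`_0 = 0 -> q = 0.
Proof.
move=> rq q0; apply/polyP => k; rewrite coef0; elim: k => // k qk.
have /eqP := rq k; rewrite qk mulr0 mulf_eq0 gt_eqF ?jacobi_rec_coef_gt0//=.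
by move/eqP.
Qed.

Lemma jacobi_rec_colinear (p q : {poly R}) : p != 0 ->
  jacobi_rec alpha beta gamma p -> jacobi_rec alpha beta gamma q ->
  exists c : R, q = c *: p.
Proof.
move=> pN0 rp rq.
have p0 : p`_0 != 0 by apply: contra_neq pN0 => /(jacobi_rec_eq0 rp).
(* This scalar cancels the constant coefficient of [q - c *: p]. *)
exists (q`_0 / p`_0); apply/eqP; rewrite -subr_eq0; apply/eqP.
apply: jacobi_rec_eq0 => [k|]; last by rewrite coefB coefZ divfK ?subrr.
rewrite !coefB !coefZ mulrBr rq mulrCA rp; ring.
Qed.

Lemma jacobi_recZ (c : R) (q : {poly R}) :
  jacobi_rec alpha beta gamma q -> jacobi_rec alpha beta gamma (c *: q).
Proof. by move=> rq k; rewrite !coefZ mulrCA rq mulrCA. Qed.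

(** At [k = n] the recurrence has left side 0, since [q] has no coefficient beyond [n]. *)
Lemma jacobi_rec_eigenvalue (n : nat) (q : {poly R}) :
  (size q <= n.+1)%N -> q`_n != 0 -> jacobi_rec alpha beta gamma q ->
  gamma = n%:R * (n%:R + alpha + beta + 1).
Proof.
move=> sq qn rq; have := rq n; rewrite nth_default// mulr0 => /esym/eqP.
by rewrite mulf_eq0 (negbTE qn) orbF subr_eq0 => /eqP.
Qed.

Lemma jacobi_rec_exists (n : nat) : -1 < beta ->
  gamma = n%:R * (n%:R + alpha + beta + 1) ->
  exists q : {poly R}, [/\ (size q <= n.+1)%N, 0 < q`_n
    & jacobi_rec alpha beta gamma q].
Proof.
move=> beta_gtN1 gE.
pose r (k : nat) := (gamma - k%:R * (k%:R + alpha + beta + 1))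
  / (2 * (k%:R + 1) * (k%:R + 1 + alpha)).
pose c (k : nat) := \prod_(i < k) r i.
have rM k : 2 * (k%:R + 1) * (k%:R + 1 + alpha) * c k.+1 =
    (gamma - k%:R * (k%:R + alpha + beta + 1)) * c k.
  rewrite /c big_ord_recr /= mulrCA [RHS]mulrC; congr (_ * _).
  by rewrite mulrC divfK// gt_eqF// jacobi_rec_coef_gt0.
exists (\poly_(k < n.+1) c k); split; first exact: size_poly.
  rewrite coef_poly ltnSn prodr_gt0// => i _.
  rewrite divr_gt0 ?jacobi_rec_coef_gt0//.
  (* Both factors are positive for [i < n]: then [n + i >= 1], while [alpha + beta > -2]. *)
  have -> : gamma - i%:R * (i%:R + alpha + beta + 1) =
      (n%:R - i%:R) * (n%:R + i%:R + alpha + beta + 1) by rewrite gE; ring.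
  have i0 : 0 <= i%:R :> R by rewrite ler0n.
  have ni : i%:R + 1 <= n%:R :> R by rewrite natr1 ler_nat.
  by rewrite mulr_gt0//; move: alpha_gtN1; lra.
move=> k; rewrite !coef_poly !ltnS.
(* Truncation is harmless: at [k = n] the eigenvalue factor vanishes, and beyond it both
   coefficients are 0. *)
have [kn|nk|->] := ltngtP k n; first by rewrite rM.
  by rewrite !mulr0.
by rewrite gE subrr mul0r mulr0.
Qed.

End Recurrence.

(** * Multiplicative polynomials as exponentials of polynomials *)

Section MultiplicativePolynomials.
Variable R : realType.

Lemma mpoly_expR (n : nat) (x0 : R) (a : 'I_n.+1 -> R) (x : R) :
  (forall k, 0 < a k) ->
  mpoly x0 a x = expR (\poly_(k < n.+1) ln (a (inord k))).[x - x0].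
Proof.
move=> a0; rewrite /mpoly horner_poly expR_sum; apply: eq_bigr => k _.
by rewrite inord_val expRM lnK ?posrE.
Qed.

Lemma is_mpoly_expR (I : set R) (y : R -> R) : is_mpoly I y ->
  exists q : {poly R}, forall x, I x -> y x = expR q.[x - 1].
Proof.
move=> [m [x0 [b [b0 yE]]]].
(* The composition moves the centre from [x0] to 1. *)
exists ((\poly_(k < m.+1) ln (b (inord k))) \Po ('X + (1 - x0)%:P)) => x Ix.
have -> : y x = expR (\poly_(k < m.+1) ln (b (inord k))).[x - x0].
  by rewrite yE// mpoly_expR.
by rewrite horner_comp hornerD hornerX hornerC addrA subrK.
Qed.

Lemma mpoly_powR (n : nat) (x0 c : R) (a : 'I_n.+1 -> R) (x : R) :
  mpoly x0 a x `^ c = mpoly x0 (fun k => a k `^ c) x.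
Proof.
rewrite /mpoly; transitivity (\prod_(k < n.+1) (a k `^ ((x - x0) ^+ k)) `^ c).
  apply/esym; elim: (index_enum _) => [|k s IHs]; first by rewrite !big_nil powR1.
  by rewrite !big_cons IHs powRM ?powR_ge0// prodr_ge0// => i _; rewrite powR_ge0.
by apply: eq_bigr => k _; rewrite powRAC.
Qed.

End MultiplicativePolynomials.

Theorem theorem3p5 (R : realType) (alpha beta gamma : R)
    (halpha : -1 < alpha) (hbeta : -1 < beta) (n : nat) :
  ((exists a : 'I_n.+1 -> R, mjacobi_mpoly_solution alpha beta gamma a) <->
     gamma = n%:R * (n%:R + alpha + beta + 1)) /\
  (forall a : 'I_n.+1 -> R, mjacobi_mpoly_solution alpha beta gamma a ->
     [/\ forall c : R,
           is_mpoly `[-1, 1] (fun x => mpoly 1 a x `^ c) /\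
           mjacobi_solution alpha beta gamma `[-1, 1]
             (fun x => mpoly 1 a x `^ c),
         forall z : R -> R,
           mjacobi_solution alpha beta gamma `[-1, 1] z ->
           is_mpoly `[-1, 1] z ->
           exists c : R,
             forall x, `[-1, 1]%classic x -> z x = mpoly 1 a x `^ c &
         forall z : R -> R,
           mjacobi_solution alpha beta gamma `]-1, 1[ z ->
           mlin_indep `]-1, 1[ (tnth [tuple mpoly 1 a; z]) ->
           ~ is_mpoly `]-1, 1[ z]).
Proof.
have oosub : `]-1, 1[ `<=` (`[-1, 1] : set R) by exact: subset_itv_oo_cc.
have oo := @subset_refl _ (`]-1, 1[ : set R).
have cc := @subset_refl _ (`[-1, 1] : set R).
pose lp (a : 'I_n.+1 -> R) := \poly_(k < n.+1) ln (a (inord k)).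
have solE (a : 'I_n.+1 -> R) : (forall k, 0 < a k) ->
    mjacobi_solution alpha beta gamma `[-1, 1] (mpoly 1 a) <->
    jacobi_rec alpha beta gamma (lp a).
  by move=> a0; apply: mjacobi_solution_expR => // x _; exact: mpoly_expR.
split; first split.
- move=> [a [a0 an _ /(solE _ a0)]]; apply: jacobi_rec_eigenvalue.
    exact: size_poly.
  rewrite coef_poly ltnSn (_ : inord n = ord_max); last first.
    by apply: val_inj; rewrite /= inordK.
  by rewrite ln_eq0.
- move=> /(jacobi_rec_exists halpha hbeta)[q [sq qn rq]].
  pose a (k : 'I_n.+1) := expR q`_k.
  have a0 k : 0 < a k by exact: expR_gt0.
  have lpa : lp a = q.
    apply/polyP => k; rewrite coef_poly; case: ltnP => [kn|nk].
      by rewrite /a expRK inordK.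
    by rewrite nth_default// (leq_trans sq).
  exists a; split=> //.
  + by rewrite /a -expR0 (inj_eq (@expR_inj R)) gt_eqF.
  + apply: contrapT => a1; suff q0 : q = 0 by rewrite q0 coef0 ltxx in qn.
    apply: poly_eq0_on => x /oosub Ix; apply: expR_inj; rewrite expR0 -lpa.
    rewrite -mpoly_expR//; apply/eqP/negPn/negP => ax.
    by apply: a1; exists x.
  + by apply/(solE _ a0); rewrite lpa.
move=> a [a0 an [x1 Ix1 ax1] /(solE _ a0) ra].
have pE c x : mpoly 1 a x `^ c = expR (c *: lp a).[x - 1].
  by rewrite mpoly_expR// -expRM hornerZ mulrC.
have lpN0 : lp a != 0.
  by apply: contra_neq ax1 => la0; rewrite mpoly_expR// -/(lp a) la0 horner0 expR0.
(* Colinear exponents give powers of one solution; this is used below on the closed and on the open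
   interval. *)
have uniq (I : set R) z : `]-1, 1[ `<=` I -> I `<=` `[-1, 1] ->
    mjacobi_solution alpha beta gamma I z -> is_mpoly I z ->
    exists c : R, forall x, I x -> z x = mpoly 1 a x `^ c.
  move=> I1 I2 sz /is_mpoly_expR[q zE].
  have /(jacobi_rec_colinear halpha lpN0 ra)[c qE] :
    jacobi_rec alpha beta gamma q by apply/(mjacobi_solution_expR _ _ _ _ _ zE).
  by exists c => x Ix; rewrite zE// qE pE.
split.
- move=> c; split.
    exists n, 1, (fun k => a k `^ c); split=> [k|x _]; last exact: mpoly_powR.
    by rewrite powR_gt0.
  apply/(mjacobi_solution_expR _ _ _ oosub cc (fun x _ => pE c x)).
  exact: jacobi_recZ.
- by move=> z; exact: uniq.
- move=> z sz indep mz; have [c zE] := uniq _ _ oo oosub sz mz.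
  (* From [z = y ^ c] follows the relation [y ^ c * z ^ (-1) = 1], so independence would force
     [-1 = 0]. *)
  pose d (i : 'I_2) : R := if i == ord0 then c else -1.
  have /(_ ord_max)/eqP : forall k, d k = 0; last by rewrite oppr_eq0 oner_eq0.
  apply: indep => x Ix; rewrite !big_ord_recl big_ord0 mulr1 !(tnth_nth 1) /=.
  rewrite /d /= zE// -powRrM !pE -expRD -hornerD -scalerDl.
  by rewrite mulrN1 subrr scale0r horner0 expR0.
Qed.
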